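(* Let $n$ be a positive integer. For every $i=1,\ldots,n$, $$(\pi^i)^\sharp_{\min}=\sigma_{[1]}\circ\cdots\circ\sigma_{[i-1]}\circ\sigma_{[i+1]}\circ\cdots\circ\sigma_{[n]}$$ as congruences on $\mathscr{IO}_{\infty}(\mathbb{Z}^n_{\mathrm{lex}})$.
   Context: $L_n=\{1,\ldots,n\}$ with its usual order; $L_n\times_{\mathrm{lex}}\mathbb{Z}$ is $L_n\times\mathbb{Z}$ with the lexicographic order: $(i,m)\leqslant(j,l)$ iff $i<j$, or $i=j$ and $m\le l$. $\mathscr{IO}_{\infty}(\mathbb{Z}^n_{\mathrm{lex}})$ is the inverse monoid of all injective partial maps $\alpha$ from $L_n\times\mathbb{Z}$ to itself that are monotone ($x\leqslant y$ in $\operatorname{dom}\alpha$ implies $(x)\alpha\leqslant(y)\alpha$) and such that both $\operatorname{dom}\alpha$ and $\operatorname{ran}\alpha$ have finite complement in $L_n\times\mathbb{Z}$; the operation is composition of partial maps written on the right, $(x)(\alpha\beta)=((x)\alpha)\beta$. $\mathscr{IO}_{\infty}(\mathbb{Z})$ is the analogous monoid of injective monotone partial selfmaps of $\mathbb{Z}$ (usual order) with cofinite domain and image. Every element of $\mathscr{IO}_{\infty}(\mathbb{Z}^n_{\mathrm{lex}})$ preserves the first coordinate, so $\mathscr{IO}_{\infty}(\mathbb{Z}^n_{\mathrm{lex}})$ is identified with the direct power $(\mathscr{IO}_{\infty}(\mathbb{Z}))^n$ by $\alpha\leftrightarrow(\alpha_1,\ldots,\alpha_n)$, where $(i,k)\alpha=(i,(k)\alpha_i)$.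 For $\varepsilon\in\mathscr{IO}_{\infty}(\mathbb{Z})$ let $\varepsilon_i^\circ$ denote the element whose $i$-th coordinate is $\varepsilon$ and whose other coordinates are the identity. The congruence $\sigma_{[i]}$ is defined by: $\alpha\,\sigma_{[i]}\,\beta$ iff there exists an idempotent $\varepsilon\in\mathscr{IO}_{\infty}(\mathbb{Z})$ such that $\alpha\varepsilon_i^\circ=\beta\varepsilon_i^\circ$. Here $\circ$ is composition of binary relations ($\alpha(\rho\circ\tau)\beta$ iff $\alpha\rho\gamma$ and $\gamma\tau\beta$ for some $\gamma$); the empty composition (when $n=1$) is the identity relation. The homomorphism $\pi^i\colon\mathscr{IO}_{\infty}(\mathbb{Z}^n_{\mathrm{lex}})\to\mathscr{IO}_{\infty}(\mathbb{Z}^n_{\mathrm{lex}})$ sends $(\alpha_1,\ldots,\alpha_n)$ to the element whose $i$-th coordinate is $\alpha_i$ and whose other coordinates are the identity; $(\pi^i)^\sharp$ is its kernel congruence ($\alpha\,(\pi^i)^\sharp\,\beta$ iff $(\alpha)\pi^i=(\beta)\pi^i$). For a congruence $\rho$ on an inverse semigroup $S$, the congruence $\rho_{\min}$ is defined by: $a\,\rho_{\min}\,b$ iff $ae=be$ for some idempotent $e\in S$ with $e\,\rho\,a^{-1}a\,\rho\,b^{-1}b$. *)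

(* Defs.v *)
From HB Require Import structures.
From mathcomp Require Import all_boot all_order all_algebra.
From mathcomp Require Import zify.
From mathcomp Require Import boolp classical_sets functions cardinality.

Set Implicit Arguments.
Unset Strict Implicit.
Unset Printing Implicit Defensive.

Import Order.TTheory.

Local Open Scope classical_set_scope.
Local Open Scope group_scope.

(* The inversion of an inverse monoid is always an involutive antiautomorphism,
   so the structure is built on top of [starMonoidType]. *)
HB.mixin Record StarMonoid_isInverse S of StarMonoid S := {
  mulgVKg : forall x : S, x * x^-1 * x = x;
  invg_uniq : forall x y : S, x * y * x = x -> y * x * y = y -> y = x^-1
}.

#[short(type="inverseMonoidType")]
HB.structure Definition InverseMonoid :=
  { S of StarMonoid_isInverse S & StarMonoid S }.

Definition idempotent_elt (S : magmaType) (e : S) : Prop := e * e = e.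

Definition kernel_rel (S T : Type) (f : S -> T) (a b : S) : Prop := f a = f b.

Definition rcomp (S : Type) (rho tau : S -> S -> Prop) (a b : S) : Prop :=
  exists c, rho a c /\ tau c b.

Definition cong_min (S : inverseMonoidType) (rho : S -> S -> Prop) (a b : S)
    : Prop :=
  exists e : S, [/\ idempotent_elt e, rho e (a^-1 * a),
    rho (a^-1 * a) (b^-1 * b) & a * e = b * e].

Lemma finite_subsingleton (T : Type) (A : set T) :
  (forall x y, A x -> A y -> x = y) -> finite_set A.
Proof.
move=> Aeq; have [->|/set0P[x Ax]] := eqVneq A set0; first exact: finite_set0.
by apply: sub_finite_set (finite_set1 x) => y Ay; exact: Aeq.
Qed.

Section PartialMaps.
Context {X : Type}.
Implicit Type f : X -> option X.

Definition pdom f : set X := [set x | exists y, f x = Some y].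
Definition pran f : set X := [set y | exists x, f x = Some y].

End PartialMaps.

Record IOinf (d : Order.disp_t) (X : orderType d) := MkIOinf {
  IOfun :> X -> option X;
  IO_inj : forall x y z, IOfun x = Some z -> IOfun y = Some z -> x = y;
  IO_mono : forall x y u v,
    IOfun x = Some u -> IOfun y = Some v -> (x <= y)%O -> (u <= v)%O;
  IO_dom : cofinite_set (pdom IOfun);
  IO_ran : cofinite_set (pran IOfun)
}.

Section IOinfMonoid.
Context {d : Order.disp_t} {X : orderType d}.
Notation M := (IOinf X).
Implicit Types (a b c : M) (x y z : X).

Lemma IOP a b : (forall x, a x = b x) -> a = b.
Proof.
move: a b => [f f1 f2 f3 f4] [g g1 g2 g3 g4] /= /funext fg.
move: fg f1 f2 f3 f4 g1 g2 g3 g4 => -> *.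
by congr MkIOinf; apply: Prop_irrelevance.
Qed.

Definition one_fun x : option X := Some x.

Lemma one_fun_inj x y z : one_fun x = Some z -> one_fun y = Some z -> x = y.
Proof. by move=> [->] [->]. Qed.
Lemma one_fun_mono x y u v :
  one_fun x = Some u -> one_fun y = Some v -> (x <= y)%O -> (u <= v)%O.
Proof. by move=> [->] [->]. Qed.
Lemma one_fun_dom : cofinite_set (pdom one_fun).
Proof.
suff -> : pdom one_fun = setT by exact: cofinite_setT.
by apply/seteqP; split=> // x _; exists x.
Qed.
Lemma one_fun_ran : cofinite_set (pran one_fun).
Proof.
suff -> : pran one_fun = setT by exact: cofinite_setT.
by apply/seteqP; split=> // x _; exists x.
Qed.

Definition IOone : M := MkIOinf one_fun_inj one_fun_mono one_fun_dom one_fun_ran.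

(* Maps act on the right: [mul_fun a b] applies [a] first. *)
Definition mul_fun a b x : option X := obind b (a x).

Lemma mul_funP a b x z :
  mul_fun a b x = Some z <-> exists y, a x = Some y /\ b y = Some z.
Proof.
rewrite /mul_fun; case: (a x) => [y|] /=; split=> //.
- by exists y.
- by move=> [_ [[<-]]].
- by move=> [y []].
Qed.

Lemma mul_fun_inj a b x y z :
  mul_fun a b x = Some z -> mul_fun a b y = Some z -> x = y.
Proof.
move=> /mul_funP[u [au bu]] /mul_funP[v [av bv]].
by apply: IO_inj au _; rewrite (IO_inj bu bv).
Qed.
Lemma mul_fun_mono a b x y u v :
  mul_fun a b x = Some u -> mul_fun a b y = Some v -> (x <= y)%O -> (u <= v)%O.
Proof.
move=> /mul_funP[u' [au bu]] /mul_funP[v' [av bv]] xy.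
exact: IO_mono bu bv (IO_mono au av xy).
Qed.

Lemma finite_preim a (A : set X) :
  finite_set A -> finite_set [set x | exists2 y, A y & a x = Some y].
Proof.
move=> Af; apply: (@sub_finite_set _ _ (\bigcup_(y in A) [set x | a x = Some y])).
  by move=> x [y Ay axy]; exists y.
by apply: bigcup_finite => // y _; apply: finite_subsingleton => x x'; exact: IO_inj.
Qed.

Lemma finite_direct a (A : set X) :
  finite_set A -> finite_set [set y | exists2 x, A x & a x = Some y].
Proof.
move=> Af; apply: (@sub_finite_set _ _ (\bigcup_(x in A) [set y | a x = Some y])).
  by move=> y [x Ax axy]; exists x.
apply: bigcup_finite => // x _; apply: finite_subsingleton => y y' /= -> [//].
Qed.

Lemma mul_fun_dom a b : cofinite_set (pdom (mul_fun a b)).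
Proof.
apply: (@sub_finite_set _ _
  (~` pdom a `|` [set x | exists2 y, (~` pdom b) y & a x = Some y])).
  move=> x /= nx; have [[y axy]|nax] := pselect (pdom a x); last by left.
  right; exists y => //= -[z bz]; apply: nx; exists z.
  by apply/mul_funP; exists y.
by rewrite finite_setU; split; [exact: IO_dom|exact/finite_preim/IO_dom].
Qed.

Lemma mul_fun_ran a b : cofinite_set (pran (mul_fun a b)).
Proof.
apply: (@sub_finite_set _ _
  (~` pran b `|` [set z | exists2 y, (~` pran a) y & b y = Some z])).
  move=> z /= nz; have [[y byz]|nbz] := pselect (pran b z); last by left.
  right; exists y => //= -[x axy]; apply: nz; exists x.
  by apply/mul_funP; exists y.
by rewrite finite_setU; split; [exact: IO_ran|exact/finite_direct/IO_ran].
Qed.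

Definition IOmul a b : M :=
  MkIOinf (@mul_fun_inj a b) (@mul_fun_mono a b) (mul_fun_dom a b)
    (mul_fun_ran a b).

Definition inv_fun a y : option X :=
  if pselect (exists x, a x = Some y) is left axy then Some (projT1 (cid axy))
  else None.

Lemma inv_funP a x y : inv_fun a y = Some x <-> a x = Some y.
Proof.
rewrite /inv_fun; case: pselect => [axy|naxy]; last first.
  by split=> // axy; case: naxy; exists x.
by case: cid => x' /= ax'; split=> [[<-]//|ax]; rewrite (IO_inj ax' ax).
Qed.

Lemma inv_fun_inj a x y z : inv_fun a x = Some z -> inv_fun a y = Some z -> x = y.
Proof. by move=> /inv_funP azx /inv_funP; rewrite azx => -[]. Qed.

Lemma inv_fun_mono a x y u v :
  inv_fun a x = Some u -> inv_fun a y = Some v -> (x <= y)%O -> (u <= v)%O.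
Proof.
move=> /inv_funP aux /inv_funP avy xy; rewrite leNgt; apply/negP => vu.
have yx := IO_mono avy aux (ltW vu).
have exy : x = y by apply/le_anti/andP.
by move: vu; rewrite exy in aux; rewrite (IO_inj aux avy) ltxx.
Qed.

Lemma inv_fun_dom a : cofinite_set (pdom (inv_fun a)).
Proof.
apply: sub_finite_set (IO_ran a); apply: subsetC => y [x axy].
by exists x; apply/inv_funP.
Qed.

Lemma inv_fun_ran a : cofinite_set (pran (inv_fun a)).
Proof.
apply: sub_finite_set (IO_dom a); apply: subsetC => x [y axy].
by exists y; apply/inv_funP.
Qed.

Definition IOinv a : M :=
  MkIOinf (@inv_fun_inj a) (@inv_fun_mono a) (inv_fun_dom a) (inv_fun_ran a).

Lemma IO_graph a b :
  (forall x y, a x = Some y <-> b x = Some y) -> a = b.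
Proof.
move=> ab; apply: IOP => x.
case ax: (a x) => [y|]; first by apply/esym/ab.
by case bx: (b x) => [y|//]; move/ab: bx; rewrite ax.
Qed.

Lemma IOmulA : associative IOmul.
Proof.
by move=> a b c; apply: IOP => x; rewrite /= /mul_fun /= /mul_fun; case: (a x).
Qed.

Lemma IOmul1 : left_id IOone IOmul.
Proof. by move=> a; apply: IOP. Qed.

Lemma IOinvK : involutive IOinv.
Proof.
move=> a; apply: IO_graph => x y; split.
  by move=> /inv_funP /inv_funP.
by move=> axy; apply/inv_funP/inv_funP.
Qed.

Lemma IOinvM : {morph IOinv : a b / IOmul a b >-> IOmul b a}.
Proof.
move=> a b; apply: IO_graph => z x; split.
  move=> /inv_funP /mul_funP[y [axy byz]].
  by apply/mul_funP; exists y; split; apply/inv_funP.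
move=> /mul_funP[y [/inv_funP byz /inv_funP axy]].
by apply/inv_funP/mul_funP; exists y.
Qed.

HB.instance Definition _ := gen_eqMixin M.
HB.instance Definition _ := gen_choiceMixin M.
HB.instance Definition _ :=
  isStarMonoid.Build M IOmulA IOmul1 IOinvK IOinvM.

Lemma IOmulVK a : a * a^-1 * a = a.
Proof.
apply: IO_graph => x y; split.
  move=> /mul_funP[x' [/mul_funP[y' [ay' /inv_funP ax'y']] ax'y]].
  by rewrite (IO_inj ay' ax'y').
move=> axy; apply/mul_funP; exists x; split=> //; apply/mul_funP.
by exists y; split=> //; apply/inv_funP.
Qed.

Lemma IOinv_uniq a b : a * b * a = a -> b * a * b = b -> b = a^-1.
Proof.
have key a' b' x y : a' * b' * a' = a' -> a' x = Some y -> b' y = Some x.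
  move=> /(congr1 (fun c : M => c x)) + axy; rewrite axy.
  move=> /mul_funP[x' [/mul_funP[y' [ay' by'x']] ax'y]].
  move: ay'; rewrite axy => -[yy']; rewrite -yy' in by'x'.
  by rewrite by'x' (IO_inj axy ax'y).
move=> aba bab; apply: IO_graph => y x; split.
  by move=> byx; apply/inv_funP; exact: key bab byx.
by move=> /inv_funP; exact: key aba.
Qed.

HB.instance Definition _ := StarMonoid_isInverse.Build M IOmulVK IOinv_uniq.

End IOinfMonoid.

Lemma IO_mulE (d : Order.disp_t) (X : orderType d) (a b : IOinf X) x :
  (a * b) x = obind b (a x).
Proof. by []. Qed.

Lemma IO_oneE (d : Order.disp_t) (X : orderType d) (x : X) :
  (1 : IOinf X) x = Some x.
Proof. by []. Qed.

Lemma IO_invP (d : Order.disp_t) (X : orderType d) (a : IOinf X) x y :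
  a^-1 y = Some x <-> a x = Some y.
Proof. exact: inv_funP. Qed.

(* The chain L_n = {1, ..., n} is represented by ['I_n] = {0, ..., n-1}. *)
Notation IOZ := (IOinf int).
Notation IOZlex n := (IOinf ('I_n *l int)%type).
Section Lex.
Context {n : nat}.
Notation Zlex := ('I_n *l int)%type.
Implicit Types (a b : IOZlex n) (p q : Zlex) (i j : 'I_n) (k l : int).

Lemma lexE i j k l :
  (((i, k) : Zlex) <= (j, l))%O = ((i < j)%O || ((i == j) && (k <= l)%O)).
Proof. by rewrite leEprodlexi /=; case: (ltgtP i j). Qed.

Lemma finite_int_itv k l : finite_set [set m : int | (k <= m <= l)%O].
Proof.
apply: sub_finite_set (finite_image (fun m : nat => (k + m%:Z)%R)
  (finite_II (absz (l - k)%R).+1)).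
move=> m /= /andP[km ml]; exists (absz (m - k)%R).
  by rewrite ltnS; lia.
lia.
Qed.

Lemma infinite_int_ray k : ~ finite_set [set m : int | (k <= m)%O].
Proof.
move=> fin; apply: infinite_nat.
apply: sub_finite_set (finite_image (fun m : int => absz (m - k)%R) fin).
by move=> m _ /=; exists (k + m%:Z)%R; lia.
Qed.

Lemma IO_col_eq a i k j l j' l' k' :
  a (i, k) = Some (j, l) -> a (i, k') = Some (j', l') -> j = j'.
Proof.
wlog kk' : j l k j' l' k' / (k <= k')%O.
  move=> wl; case: (leP k k') => [/wl h|/ltW /wl h] h1 h2; first exact: h h1 h2.
  by rewrite (h _ _ _ _ h2 h1).
move=> e1 e2.
have le1 : (((i, k) : Zlex) <= (i, k'))%O by rewrite lexE eqxx kk' orbT.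
have := IO_mono e1 e2 le1; rewrite lexE => /orP[jj'|/andP[/eqP]//].
pose A : set Zlex := [set p | p.1 = i /\ (k <= p.2 <= k')%O].
have Af : finite_set A.
  apply: sub_finite_set (finite_image (fun m : int => (i, m)) (finite_int_itv k k')).
  by move=> [i' m] [ei mk]; exists m => //=; rewrite -ei.
pose B : set Zlex := [set p | exists2 q, A q & a q = Some p].
have Bf : finite_set (B `|` ~` pran a).
  by rewrite finite_setU; split; [exact: finite_direct|exact: IO_ran].
exfalso; apply: (@infinite_int_ray l).
apply: sub_finite_set (finite_image (fun p : Zlex => p.2) Bf).
move=> m /= lm; exists (j, m) => //.
have [[[i' k''] e]|] := pselect (pran a (j, m)); last by right.
left; exists (i', k'') => //.
have mon p q u v : a p = Some u -> a q = Some v -> (u <= v)%O -> (p <= q)%O.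
  by move=> /IO_invP ap /IO_invP aq; exact: IO_mono ap aq.
have := mon _ _ _ _ e1 e; rewrite lexE eqxx lm orbT => /(_ isT).
have := mon _ _ _ _ e e2; rewrite lexE jj' => /(_ isT).
rewrite !lexE; case: (ltgtP i' i) => //= -> h1 h2.
by split=> //=; rewrite h1 h2.
Qed.

Lemma IO_col_dom a i : exists k p, a (i, k) = Some p.
Proof.
apply: contrapT => nk; apply: (@infinite_int_ray 0%R).
apply: sub_finite_set (finite_image (fun p : Zlex => p.2) (IO_dom a)).
by move=> m _; exists (i, m) => //= -[p e]; apply: nk; exists m, p.
Qed.

Lemma homo_inj_ord_ge (f : 'I_n -> 'I_n) :
  {homo f : i j / (i < j)%N} -> forall i, (i <= f i)%N.
Proof.
move=> fh [m]; elim: m => [//|m IH] mn /=.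
have mn' := ltnW mn.
by apply: leq_ltn_trans (IH mn') _; apply: fh => /=.
Qed.

Lemma homo_surj_ord_id (f g : 'I_n -> 'I_n) :
  {homo f : i j / (i <= j)%N} -> cancel g f -> f =1 id.
Proof.
move=> fh gf; have gb := injF_bij (can_inj gf).
have fg : cancel f g by move=> i; have [h h1 h2] := gb; rewrite -(h2 i) gf.
have fs : {homo f : i j / (i < j)%N}.
  move=> i j ij; rewrite ltn_neqAle (fh _ _ (ltnW ij)) andbT.
  by apply/eqP => /val_inj /(can_inj fg) ?; subst; rewrite ltnn in ij.
have gs : {homo g : i j / (i < j)%N}.
  move=> i j ij; rewrite ltnNge; apply/negP => /fh.
  by rewrite !gf leqNgt ij.
move=> i; apply/val_inj/eqP; rewrite eqn_leq (homo_inj_ord_ge fs) andbT.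
by have := homo_inj_ord_ge gs (f i); rewrite fg.
Qed.

Lemma IO_fst a p q : a p = Some q -> q.1 = p.1.
Proof.
pose P a i := fun j => exists k l, a (i, k) = Some (j, l).
have Pex b i : exists j, P b i j.
  by have [k [[j l] e]] := IO_col_dom b i; exists j, k, l.
pose f i := projT1 (cid (Pex a i)); pose g i := projT1 (cid (Pex a^-1 i)).
have fP i k j l : a (i, k) = Some (j, l) -> f i = j.
  move=> e; rewrite /f; case: cid => j' /= [k' [l' e']].
  exact: IO_col_eq e' e.
have gf : cancel g f.
  move=> i; rewrite /g; case: cid => j /= [k [l /IO_invP]].
  exact: fP.
have fh : {homo f : i j / (i <= j)%N}.
  move=> i j; rewrite leq_eqVlt => /orP[/eqP/val_inj -> //|ij].
  have [k [[i' l] e]] := IO_col_dom a i; have [k' [[j' l'] e']] := IO_col_dom a j.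
  rewrite (fP _ _ _ _ e) (fP _ _ _ _ e').
  have := IO_mono e e'; rewrite !lexE ltEord ij => /(_ isT).
  by move=> /orP[/ltnW //|/andP[/eqP ->]].
move: p q => [i k] [j l] /= e.
by rewrite -(fP _ _ _ _ e) (homo_surj_ord_id fh gf).
Qed.

Definition power_fun (f : 'I_n -> IOZ) p : option Zlex :=
  omap (fun l => (p.1, l)) (f p.1 p.2).

Lemma power_funP (f : 'I_n -> IOZ) i k j l :
  power_fun f (i, k) = Some (j, l) <-> j = i /\ f i k = Some l.
Proof.
rewrite /power_fun /=; case: (f i k) => [m|] /=; split=> //.
- by move=> [<- <-].
- by move=> [-> [->]].
- by case.
Qed.

Lemma power_fun_inj f p q u :
  power_fun f p = Some u -> power_fun f q = Some u -> p = q.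
Proof.
move: p q u => [i k] [j l] [i' m] /power_funP[-> e] /power_funP[eij e'].
by subst j; rewrite (IO_inj e e').
Qed.

Lemma power_fun_mono f p q u v :
  power_fun f p = Some u -> power_fun f q = Some v -> (p <= q)%O -> (u <= v)%O.
Proof.
move: p q u v => [i k] [j l] [i' k'] [j' l'].
move=> /power_funP[-> e] /power_funP[-> e']; rewrite !lexE.
case/orP => [->//|/andP[/eqP ij kl]]; apply/orP; right; subst j.
by rewrite eqxx (IO_mono e e' kl).
Qed.

Lemma finite_columns (A : 'I_n -> set int) :
  (forall i, finite_set (A i)) -> finite_set [set p : Zlex | A p.1 p.2].
Proof.
move=> Af; apply: (@sub_finite_set _ _
    (\bigcup_(i in setT) ((fun k => (i, k) : Zlex) @` A i))).
  by move=> [i k] /= Aik; exists i => //; exists k.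
by apply: bigcup_finite => [|i _]; [exact: finite_finset|exact: finite_image].
Qed.

Lemma power_fun_dom f : cofinite_set (pdom (power_fun f)).
Proof.
apply: sub_finite_set (finite_columns (fun i => IO_dom (f i))).
move=> [i k] /= np [l e]; apply: np; exists (i, l).
exact/power_funP.
Qed.

Lemma power_fun_ran f : cofinite_set (pran (power_fun f)).
Proof.
apply: sub_finite_set (finite_columns (fun i => IO_ran (f i))).
move=> [i k] /= np [l e]; apply: np; exists (i, l).
exact/power_funP.
Qed.

(* [power (a_1, ..., a_n)] maps [(i, k)] to [(i, (k) a_i)]. *)
Definition power (f : 'I_n -> IOZ) : IOZlex n :=
  MkIOinf (@power_fun_inj f) (@power_fun_mono f) (power_fun_dom f)
    (power_fun_ran f).

(* The first component of [a (i, k)] is [i] by [IO_fst]. *)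
Definition coord_fun a i k : option int := omap snd (a (i, k)).

Lemma coord_funP a i k l : coord_fun a i k = Some l <-> a (i, k) = Some (i, l).
Proof.
rewrite /coord_fun; split=> [|-> //].
case e: (a (i, k)) => [[j m]|] //= [<-].
by move: (IO_fst e) => /= ->.
Qed.

Lemma coord_fun_inj a i k l m :
  coord_fun a i k = Some m -> coord_fun a i l = Some m -> k = l.
Proof. by move=> /coord_funP e /coord_funP e'; case: (IO_inj e e'). Qed.

Lemma coord_fun_mono a i k l k' l' :
  coord_fun a i k = Some k' -> coord_fun a i l = Some l' ->
  (k <= l)%O -> (k' <= l')%O.
Proof.
move=> /coord_funP e /coord_funP e' kl.
by have := IO_mono e e'; rewrite !lexE !ltxx !eqxx /=; exact.
Qed.

Lemma coord_fun_dom a i : cofinite_set (pdom (coord_fun a i)).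
Proof.
apply: sub_finite_set (finite_image (fun p : Zlex => p.2) (IO_dom a)).
move=> k nk; exists (i, k) => //= -[[j l] e]; apply: nk; exists l.
by rewrite /coord_fun e.
Qed.

Lemma coord_fun_ran a i : cofinite_set (pran (coord_fun a i)).
Proof.
apply: sub_finite_set (finite_image (fun p : Zlex => p.2) (IO_ran a)).
move=> l nl; exists (i, l) => //= -[[j k] e]; apply: nl; exists k.
apply/coord_funP; have /= ij := IO_fst e; subst j; exact: e.
Qed.

Definition coord a i : IOZ :=
  MkIOinf (@coord_fun_inj a i) (@coord_fun_mono a i) (coord_fun_dom a i)
    (coord_fun_ran a i).

Lemma powerK : cancel power coord.
Proof.
move=> f; apply/funext => i; apply: IO_graph => k l.
split=> [/coord_funP/power_funP[]//|e].
exact/coord_funP/power_funP.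
Qed.

Lemma coordK : cancel coord power.
Proof.
move=> a; apply: IO_graph => -[i k] [j l]; split.
  by move=> /power_funP[-> /coord_funP].
by move=> e; have /= ij := IO_fst e; subst j; apply/power_funP; move/coord_funP: e.
Qed.

Lemma coord1 i : coord 1 i = 1.
Proof. exact: IOP. Qed.

Lemma coordM a b i : coord (a * b) i = coord a i * coord b i.
Proof.
apply: IOP => k; rewrite IO_mulE /= /coord_fun IO_mulE.
by case e: (a (i, k)) => [[j l]|] //=; have /= -> := IO_fst e.
Qed.

Lemma coord_inj a b : coord a =1 coord b -> a = b.
Proof. by move=> /funext ab; rewrite -[a]coordK ab coordK. Qed.

Definition at_coord i (e : IOZ) : IOZlex n :=
  power (fun j => if j == i then e else 1).

Definition sigma i a b : Prop :=
  exists e : IOZ, idempotent_elt e /\ a * at_coord i e = b * at_coord i e.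

Definition proj i a : IOZlex n := at_coord i (coord a i).

Lemma at_coordM i (e f : IOZ) : at_coord i (e * f) = at_coord i e * at_coord i f.
Proof.
apply: coord_inj => j; rewrite coordM !powerK.
by case: eqP => // _; rewrite mul1g.
Qed.

Lemma at_coord1 i : at_coord i 1 = 1.
Proof. by apply: coord_inj => j; rewrite powerK coord1 if_same. Qed.

Fact proj_monoid_morphism i : monoid_morphism (proj i).
Proof.
split; first by rewrite /proj coord1 at_coord1.
by move=> a b; rewrite /proj coordM at_coordM.
Qed.

HB.instance Definition _ i :=
  isUMagmaMorphism.Build (IOZlex n) (IOZlex n) (proj i)
    (proj_monoid_morphism i).

End Lex.

(* Main.v *)
(* Coordinatewise, both sides say the same thing: [a] and [b] agree at [i], and
   at each other coordinate they agree after multiplication by an idempotent.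
   On the left, [e] has [i]-th coordinate [a_i^-1 a_i = b_i^-1 b_i], so
   [a e = b e] forces [a_i = b_i]; on the right, each [sigma j] alters only the
   [j]-th coordinate. *)
Require Import Defs.
From mathcomp Require Import all_boot all_order all_algebra.
From mathcomp Require Import boolp.

(* The unqualified [coord] is the one of [vector]. *)
Local Notation coord := Defs.coord.

Local Open Scope group_scope.

(** On an inverse monoid this is the least group congruence. *)
Definition idem_related {S : magmaType} (x y : S) : Prop :=
  exists e, idempotent_elt e /\ x * e = y * e.

Section Coordinates.
Context {n : nat}.
Implicit Types (a b : IOZlex n) (i j : 'I_n).

Lemma coordP a b : a = b <-> forall j, coord a j = coord b j.
Proof. by split=> [-> //|]; exact: coord_inj. Qed.

(** Taking coordinates is multiplicative, so [coord a^-1 i] satisfies the two equations that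
    determine the inverse. *)
Lemma coordV a i : coord a^-1 i = (coord a i)^-1.
Proof. by apply: invg_uniq; rewrite -!coordM ?mulgVKg // -{2}[a]invgK mulgVKg. Qed.

Lemma coord_at i (e : IOZ) j : coord (at_coord i e) j = if j == i then e else 1.
Proof. by rewrite powerK. Qed.

Lemma kernel_projP i a b : kernel_rel (proj i) a b <-> coord a i = coord b i.
Proof.
rewrite /kernel_rel /proj; split=> [|-> //].
by move=> /(congr1 (fun c => coord c i)); rewrite !coord_at eqxx.
Qed.

Lemma idempotent_coordP a :
  idempotent_elt a <-> forall j, idempotent_elt (coord a j).
Proof.
rewrite /idempotent_elt coordP.
by split=> h j; move: (h j); rewrite coordM.
Qed.

Lemma sigmaP j a b :
  sigma j a b <->
  idem_related (coord a j) (coord b j) /\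
  (forall k, k != j -> coord a k = coord b k).
Proof.
split=> [[e [ee /coordP abe]]|[[e [ee abe]] ab]].
  split=> [|k /negbTE kj].
    by exists e; have := abe j; rewrite !coordM coord_at eqxx.
  by have := abe k; rewrite !coordM coord_at kj !mulg1.
exists e; split=> //; apply/coordP => k; rewrite !coordM coord_at.
by case: eqVneq => [-> //|/ab ->].
Qed.

(** Induction on [s]: without repetitions each coordinate changes in at most one factor, so one
    idempotent per coordinate suffices. *)
Lemma big_sigmaP (s : seq 'I_n) (P : pred 'I_n) a b : uniq s ->
  (\big[@rcomp (IOZlex n) / @eq (IOZlex n)]_(j <- s | P j) sigma j) a b <->
  forall k, if (k \in s) && P k then idem_related (coord a k) (coord b k)
            else coord a k = coord b k.
Proof.
elim: s a b => [|j s IH] a b /=; first by rewrite big_nil coordP.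
move=> /andP[js us]; rewrite big_cons; case: ifPn => Pj; last first.
  rewrite IH //; split=> h k; move: (h k); rewrite in_cons;
    by case: (eqVneq k j) => [->|//]; rewrite (negbTE Pj) !andbF.
split=> [[c [/sigmaP[acj ac] /(IH _ _ us) cb]] k|ab].
  (* As [j] is not in [s], the tail makes [c] and [b] agree at [j]; at any other [k], [a] and [c]
     agree. *)
  have := cb k; rewrite in_cons; case: eqVneq => [->|kj] /=.
    by rewrite Pj (negbTE js) /= => <-.
  by rewrite ac.
(* The intermediate element has already moved to [b] at [j] and is still [a] elsewhere. *)
pose c := power (fun k => if k == j then coord b j else coord a k).
have cE k : coord c k = if k == j then coord b j else coord a k.
  by rewrite powerK.
exists c; split.
  apply/sigmaP; split=> [|k /negbTE kj]; last by rewrite cE kj.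
  by rewrite cE eqxx; have := ab j; rewrite in_cons eqxx Pj.
apply/IH => // k; rewrite cE; have := ab k; rewrite in_cons.
by case: eqVneq => [->|//]; rewrite (negbTE js).
Qed.

Lemma cong_min_kernel_projP i a b :
  cong_min (kernel_rel (proj i)) a b <->
  forall k, if k != i then idem_related (coord a k) (coord b k)
            else coord a k = coord b k.
Proof.
split=> [[e [/idempotent_coordP ee /kernel_projP ea /kernel_projP eab /coordP]]|ab].
  move=> abe k; have := abe k; rewrite !coordM.
  case: eqVneq => [->|_] /= abk; last by exists (coord e k).
  move: ea eab abk; rewrite !coordM !coordV => -> ab.
  by rewrite {2}ab !mulgA !mulgVKg.
have abi : coord a i = coord b i by have := ab i; rewrite eqxx.
(* At [i] the kernel condition prescribes the idempotent [a_i^-1 a_i], which works because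
   [a_i = b_i]; elsewhere any witness of [idem_related] will do. *)
have /choice[f fP] k : exists e : IOZ, [/\ idempotent_elt e,
    coord a k * e = coord b k * e &
    k = i -> e = coord (a^-1 * a) i].
  have := ab k; case: eqVneq => [-> _|/eqP ki [e [ee abe]]]; last by exists e.
  exists (coord (a^-1 * a) i); split; rewrite ?abi //.
  (* This is [mulgVKg] for [a^-1], with [a] written as its double inverse. *)
  by rewrite /idempotent_elt -coordM mulgA -{2}[a]invgK mulgVKg.
exists (power f); split.
- by apply/idempotent_coordP => k; rewrite powerK; case: (fP k).
- by apply/kernel_projP; rewrite powerK; case: (fP i) => _ _ ->.
- by apply/kernel_projP; rewrite !coordM !coordV abi.
- by apply/coordP => k; rewrite !coordM powerK; case: (fP k).
Qed.

End Coordinates.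

Theorem proposition2p17 (n : nat) (hn : (0 < n)%N) (i : 'I_n)
    (a b : IOZlex n) :
  cong_min (kernel_rel (proj i)) a b <->
  (\big[@rcomp (IOZlex n) / @eq (IOZlex n)]_(j < n | j != i) sigma j) a b.
Proof.
rewrite cong_min_kernel_projP big_sigmaP ?index_enum_uniq //.
by split=> h k; move: (h k); rewrite mem_index_enum.
Qed.
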